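(* Let $w$ be a non-empty word over the alphabet $\{0,1\}$, and let $N_{w,2}$, $v_2(w)$, $L(w)$ be as defined in the context. Then: (i) if $w = 0^j$ for some integer $j \geq 1$, $$\prod_{n \geq 1} \left(\frac{(4n+2)(4n+2)}{(4n+1)(4n+3)}\right)^{2 N_{w,2}(n)} = \frac{2^{j+2}\,\Gamma\!\left(\frac{1}{2^j}\right)}{\Gamma\!\left(\frac{1}{2^{j+1}}\right)^2};$$ (ii) if $w$ is not of the form $0^j$ for any $j \geq 1$, $$\prod_{n \geq 1} \left(\frac{(4n+2)(4n+2)}{(4n+1)(4n+3)}\right)^{2 N_{w,2}(n)} = \frac{\Gamma\!\left(\frac{v_2(w)}{2^{L(w)}}\right)\Gamma\!\left(\frac{v_2(w)+1}{2^{L(w)}}\right)}{\Gamma\!\left(\frac{2v_2(w)+1}{2^{L(w)+1}}\right)^2}.$$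
   Context: A word over $\{0,1\}$ is a finite sequence of symbols from $\{0,1\}$; $L(w)$ denotes its length, and $0^j$ denotes the word consisting of $j$ zeros. $v_2(w)$ is the integer whose base-$2$ expansion (possibly with leading zeros) is $w$. For an integer $n>0$, $N_{w,2}(n)$ is defined as follows: if $w$ begins with $1$ or $w = 0^j$ for some $j\ge 1$, $N_{w,2}(n)$ is the number of (possibly overlapping) occurrences of $w$ as a block of consecutive digits in the binary expansion of $n$ (written without leading zeros); if $w$ begins with $0$ but is not of the form $0^j$, $N_{w,2}(n)$ is the number of possibly overlapping occurrences of $w$ in the binary expansion of $n$ preceded by arbitrarily many zeros. Also $N_{w,2}(0)=0$. $\Gamma$ is Euler's Gamma function. *)

(* Defs.v *)
From HB Require Import structures.
From mathcomp Require Import all_boot all_order all_algebra.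
From mathcomp Require Import all_classical all_reals all_analysis.
Set Implicit Arguments.
Unset Strict Implicit.
Unset Printing Implicit Defensive.
Import Order.TTheory GRing.Theory Num.Theory.
Import numFieldNormedType.Exports.

(* Words over {0,1} are boolean sequences read from left to right, with
   [false] for 0 and [true] for 1; L(w) is [size w] and 0^j is
   [nseq j false]. *)

(* The leftmost letter is the most significant digit. *)
Definition v2 (w : seq bool) : nat := foldl (fun v (b : bool) => v.*2 + b) 0 w.

(* [up_log 2 n.+1] is the least [e] with n < 2^e, i.e. the number of binary
   digits of n; the expansion of 0 is the empty word. *)
Definition binexp (n : nat) : seq bool :=
  [seq odd (n %/ 2 ^ i) | i <- rev (iota 0 (up_log 2 n.+1))].

(* Positions at which the (non-empty) word [w] occurs as a block of [s];
   occurrences may overlap. *)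
Definition occ (w s : seq bool) : nat :=
  count (fun i => prefix w (drop i s)) (iota 0 (size s)).

(* When w begins with 0 without being a power of 0, "preceded by arbitrarily
   many zeros" is realised by [size w] leading zeros: by [occ_padding] below,
   any larger number of leading zeros gives the same count. *)
Definition Nw (w : seq bool) (n : nat) : nat :=
  if head false w || (w == nseq (size w) false) then occ w (binexp n)
  else occ w (nseq (size w) false ++ binexp n).

Lemma binexp_head n : 0 < n -> head false (binexp n).
Proof.
move=> n0; rewrite /binexp.
have /andP[] := @up_log_bounds 2 n.+1 isT n0.
case: (up_log 2 n.+1) => [|k]; first by move=> _; rewrite ltnS leqNgt n0.
rewrite [k.+1.-1]/= ltnS => kn nk.
rewrite -[in iota _ _]addn1 iotaD rev_cat /=.
suff -> : n %/ 2 ^ k = 1 by [].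
apply/eqP; rewrite eqn_leq -ltnS ltn_divLR ?expn_gt0// -expnS nk /=.
by rewrite divn_gt0 ?expn_gt0.
Qed.

(* Together with [binexp_head], this identifies [binexp n] as the binary
   expansion of n without leading zeros. *)
Lemma v2_binexp n : v2 (binexp n) = n.
Proof.
have H k m : v2 [seq odd (m %/ 2 ^ i) | i <- rev (iota 0 k)] = m %% 2 ^ k.
  elim: k m => [|k IH] m; first by rewrite modn1.
  rewrite /= rev_cons map_rcons -cats1 /v2 foldl_cat /= divn1.
  rewrite (iotaDl 1) -map_rev -map_comp.
  under eq_map => i do rewrite /= add1n expnS divnMA.
  have := IH (m %/ 2); rewrite /v2 => ->.
  rewrite modn_divl -expnSr -muln2 -modn2.
  have /(modn_dvdm m) <- : 2 %| 2 ^ k.+1 by rewrite expnS dvdn_mulr.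
  by rewrite -divn_eq.
rewrite /binexp H modn_small//; exact: (@up_logP 2 n.+1 isT).
Qed.

Lemma occ_padding (w s : seq bool) (k : nat) : size w <= k ->
  w != nseq (size w) false ->
  occ w (nseq k false ++ s) = occ w (nseq (size w) false ++ s).
Proof.
move=> /subnK <- w0; elim: (k - size w) => [//|m IH].
rewrite addSn -IH /occ [nseq _.+1 _]/= cat_cons.
set t := nseq _ _ ++ s.
have key : prefix w (false :: t) = false.
  apply: contraNF w0; rewrite prefixE => /eqP {1}<-.
  rewrite /t -cat_cons -[_ :: _]/(nseq (m + size w).+1 false) take_cat.
  by rewrite size_nseq ltnS leq_addl take_nseq// leqW// leq_addl.
move: key => /= key.
rewrite [iota 0 _]/= (iotaDl 1) /= key add0n count_map.
by apply: eq_count.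
Qed.

Lemma Nw0 (w : seq bool) : w != [::] -> Nw w 0 = 0.
Proof.
have b0 : binexp 0 = [::] by rewrite /binexp up_log1.
rewrite /Nw b0 cats0 /occ size_nseq => w0.
case: ifP => // /negbT; rewrite negb_or => /andP[_ wz].
apply/eqP; rewrite -leqn0 leqNgt -has_count; apply/hasPn => i _.
apply: contra wz => /prefixP[s].
rewrite drop_nseq => /(congr1 (all (pred1 false))).
rewrite all_cat all_nseq orbT => /esym/andP[/all_pred1P {1}-> _].
by rewrite eqxx.
Qed.

Local Open Scope ring_scope.

(* Euler's integral; used only for x > 0, where it converges. *)
Definition Gamma {R : realType} (x : R) : R :=
  \int[lebesgue_measure]_(t in `]0, +oo[%classic) (t `^ (x - 1) * expR (- t)).

Definition partial_prod {R : realType} (w : seq bool) (M : nat) : R :=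
  \prod_(1 <= n < M.+1)
    (((4 * n + 2)%:R * (4 * n + 2)%:R) / ((4 * n + 1)%:R * (4 * n + 3)%:R))
      ^+ (2 * Nw w n).

(* Main.v *)
(* Put x m = (2m+1)^2 / (2m (2m+2)). Then x n / (x (2n) x (2n+1)) is the square
   of the factor ((4n+2)^2 / ((4n+1)(4n+3))) of the product, while
   N m = N (m/2) + [m = v2 w mod 2^L(w)] for m > 0, because the last digit of m
   can only create an occurrence of w at the end. Hence the product up to M
   telescopes: it equals the product of x m over the m < 2M+2 that end in w,
   divided by the product of x m ^ N m over M < m < 2M+2. The divisor tends to
   1 since x m - 1 = O(1/m^2) and N m = O(sqrt m); the first product is
   prod_k x (2^L k + v2 w), without the term k = 0 if w = 0^j, where
   x (2^L k + v2 w) = (c+k)^2 / ((c-d+k) (c+d+k)) with d = 1/2^(L+1) and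
   c = (2 v2 w + 1) d.
   By the functional equation its partial products are
   Gamma (c-d) Gamma (c+d) / Gamma c ^ 2 divided by the same quotient at c+n,
   which tends to 1: by midpoint log-convexity q u = Gamma (u+d) / Gamma u
   increases along steps of d = 1/N, and since N consecutive values of q
   multiply to u, 1 <= (q s / q (s-d))^N <= s / (s-1). *)
Require Import Defs.
From HB Require Import structures.
From mathcomp Require Import all_boot all_order all_algebra.
From mathcomp Require Import all_classical all_reals all_analysis.
From mathcomp Require Import measurable_realfun ring lra zify.
Import Order.TTheory GRing.Theory Num.Theory.
Import numFieldNormedType.Exports.
Local Open Scope classical_set_scope.
Local Open Scope ring_scope.

(** * Euler's integral *)

(** The integrand may be unbounded at [a], as [t ^ (s - 1)] is at 0 for [s < 1]. The closed
    half-lines starting at [a + 1 / (n + 1)] exhaust the open one, and monotone convergence passes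
    to the limit. *)
Lemma ge0_FTC2_oy (R : realType) (f F : R -> R) (a k l : R) :
  (forall x, a < x -> 0 <= f x) ->
  (forall x, a < x -> {for x, continuous f}) ->
  (forall x, a < x -> is_derive x 1 F (f x)) ->
  F x @[x --> a^'+] --> k -> F x @[x --> +oo%R] --> l ->
  (\int[lebesgue_measure]_(x in `]a, +oo[) (f x)%:E = (l - k)%:E)%E.
Proof.
move=> f0 cf dF Fk Fl.
pose u n : R := a + n.+1%:R^-1.
have au n : a < u n by rewrite ltrDl invr_gt0.
pose E n := `[u n, +oo[%classic.
have -> : `]a, +oo[%classic = \bigcup_n E n.
  apply/seteqP; split => x /=; last first.
    by case=> n _; rewrite /E/= !in_itv/= !andbT; apply: lt_le_trans.
  rewrite in_itv/= andbT => ax.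
  have [n nx] : exists n : nat, (x - a)^-1 <= n%:R.
    by exists (Num.truncn (x - a)^-1).+1; exact/ltW/truncnS_gt.
  exists n => //; rewrite /E/= in_itv/= andbT /u -lerBrDl.
  rewrite -[leRHS]invrK lef_pV2 ?posrE ?invr_gt0 ?subr_gt0//.
  by rewrite (le_trans nx)// ler_nat.
have cvgE : (\int[lebesgue_measure]_(x in E i) (f x)%:E @[i --> \oo] -->
    \int[lebesgue_measure]_(x in \bigcup_i E i) (f x)%:E)%E.
  apply: ge0_nondecreasing_set_cvg_integral => [m n mn|i|i|i x].
  - apply/subsetPset => x; rewrite /E/= !in_itv/= !andbT; apply: le_trans.
    by rewrite lerD2l lef_pV2 ?posrE// ler_nat.
  - exact: measurable_itv.
  - apply/measurable_EFinP.
    apply: (measurable_funS (measurable_itv `]a, +oo[)).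
      move=> x; rewrite /E/= !in_itv/= !andbT; exact: lt_le_trans.
    apply: open_continuous_measurable_fun; first exact: interval_open.
    by move=> x; rewrite inE/= in_itv/= andbT; exact: cf.
  - rewrite /E/= !in_itv/= !andbT lee_fin => ux; apply: f0.
    exact: lt_le_trans ux.
apply: (cvg_unique _ cvgE) => //.
have EE i : (\int[lebesgue_measure]_(x in E i) (f x)%:E = (l - F (u i))%:E)%E.
  rewrite EFinB; apply: ge0_continuous_FTC2y => //.
  - by move=> x ux; apply: f0; exact: lt_le_trans ux.
  - apply/continuous_within_itvcyP; split.
      by move=> x; rewrite in_itv/= andbT => ux; apply: cf; exact: lt_trans ux.
    by apply: cvg_at_right_filter; exact: cf.
  - by move=> x ux; apply: (@ex_derive _ _ _ _ _ _ _ (dF x (lt_trans (au i) ux))).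
  - apply: cvg_at_right_filter; apply: differentiable_continuous.
    by apply/derivable1_diffP; apply: (@ex_derive _ _ _ _ _ _ _ (dF _ (au i))).
  - move=> x; rewrite in_itv/= andbT => ux; rewrite derive1E.
    exact: (@derive_val _ _ _ _ _ _ _ (dF x (lt_trans (au i) ux))).
have -> : (fun i => \int[lebesgue_measure]_(x in E i) (f x)%:E)%E =
    (fun i => (l - F (u i))%:E) by apply/funext => i; exact: EE.
apply: cvg_EFin; first by near=> n.
apply: cvgB; first exact: cvg_cst.
move/cvg_at_rightP : Fk; apply; split => //.
rewrite -[X in _ --> X]addr0; apply: cvgD; first exact: cvg_cst.
exact: cvg_harmonic.
Unshelve. all: by end_near. Qed.

Section gamma.
Variable R : realType.
Implicit Types s t : R.
Notation mu := (@lebesgue_measure R).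
Notation D := (`]0, +oo[%classic : set R).
Notation g := (fun s t : R => t `^ (s - 1) * expR (- t)).

(** This is [ln y <= y - 1] at [y = t / (2 s)], multiplied by [s]. The rate 1/2 is chosen so that a
    further factor [expR (- t)] leaves the integrable [expR (- (t / 2))]. *)
Lemma powR_le_expR s t : 0 < s -> 0 < t ->
  t `^ s <= expR (s * (ln (2 * s) - 1)) * expR (t / 2).
Proof.
move=> s0 t0; rewrite /powR gt_eqF// -expRD ler_expR.
have s2 : 0 < 2 * s by rewrite mulr_gt0.
have : ln (t / (2 * s)) <= t / (2 * s) - 1.
  rewrite -[in leLHS](subrK 1 (t / _)) [X in ln X]addrC.
  by rewrite le_ln1Dx// ltrBrDl subrr divr_gt0.
rewrite ln_div ?posrE// -(ler_pM2l s0).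
have -> : s * (t / (2 * s) - 1) = t / 2 - s by field; rewrite gt_eqF.
by move=> h; lra.
Qed.

Lemma cvg_expRN2 : expR (- (x / 2)) @[x --> +oo%R] --> (0 : R).
Proof.
apply: (@cvg_comp _ _ _ (fun x : R => x / 2) (fun x => expR (- x)) _ +oo%R).
  by apply: gt0_cvgMly => //.
exact: cvgr_expR.
Qed.

Lemma is_derive_expRN t : is_derive t 1 (fun x => expR (- x)) (- expR (- t)).
Proof.
apply: is_derive_eq.
by rewrite /GRing.scale/=; ring.
Qed.

Lemma is_derive_expRN2 t :
  is_derive t 1 (fun x => expR (- (x / 2))) (- (expR (- (t / 2)) / 2)).
Proof.
apply: is_derive_eq.
by rewrite /GRing.scale/=; ring.
Qed.

Lemma continuous_expRN t : {for t, continuous (fun t : R => expR (- t))}.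
Proof.
apply: differentiable_continuous; apply/derivable1_diffP.
by have [] := is_derive_expRN t.
Qed.

Lemma continuous_gamma_integrand s t : 0 < t -> {for t, continuous (g s)}.
Proof.
move=> t0; apply: (@continuousM _ _ (fun x => x `^ (s - 1)) (fun x => expR (- x))).
  apply: differentiable_continuous; apply/derivable1_diffP.
  by apply: derivable_powR; rewrite in_itv/= t0.
exact: continuous_expRN.
Qed.

Lemma measurable_gamma_integrand s : measurable_fun D (EFin \o g s).
Proof.
apply/measurable_EFinP.
apply: open_continuous_measurable_fun; first exact: interval_open.
by move=> x; rewrite inE/= in_itv/= andbT; exact: continuous_gamma_integrand.
Qed.

Lemma continuous_expRN2 t : {for t, continuous (fun t : R => expR (- (t / 2)))}.
Proof.
apply: differentiable_continuous; apply/derivable1_diffP.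
by have [] := is_derive_expRN2 t.
Qed.

Lemma integral_expRN2 : (\int[mu]_(t in D) (expR (- (t / 2)))%:E = 2%:E)%E.
Proof.
transitivity ((-2 * 0 - -2 : R)%:E); last by congr EFin; ring.
apply: (@ge0_FTC2_oy _ _ (fun t => -2 * expR (- (t / 2)))).
- by move=> x _; exact: expR_ge0.
- by move=> x _; exact: continuous_expRN2.
- move=> x _; have := is_derive_expRN2 x => h.
  apply: is_derive_eq.
  by rewrite /GRing.scale/=; field.
- apply: cvg_at_right_filter.
  have h : expR (- (x / 2)) @[x --> (0 : R)] --> (1 : R).
    rewrite [X in _ --> X](_ : 1 = expR (- (0 / 2))).
      exact: continuous_expRN2.
    by rewrite mul0r oppr0 expR0.
  rewrite -[X in _ --> X]mulr1; apply: cvgM; last exact: h.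
  exact: cvg_cst.
- apply: cvgM; first exact: cvg_cst.
  exact: cvg_expRN2.
Qed.

Lemma ge0_integrable_fin (f : R -> R) (r : R) : measurable_fun D (EFin \o f) ->
  (forall t, 0 < t -> 0 <= f t) ->
  (\int[mu]_(t in D) (f t)%:E = r%:E)%E -> mu.-integrable D (EFin \o f).
Proof.
move=> mf f0 fr; apply/integrableP; split => //.
under eq_integral => x.
  rewrite inE/= in_itv/= andbT => x0; rewrite ger0_norm ?f0//; over.
by rewrite /= fr ltry.
Qed.

Lemma integrable_expRN2 : mu.-integrable D (EFin \o (fun t => expR (- (t / 2)))).
Proof.
apply: (@ge0_integrable_fin _ 2).
- apply/measurable_EFinP.
  apply: open_continuous_measurable_fun; first exact: interval_open.
  by move=> x _; exact: continuous_expRN2.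
- by move=> *; exact: expR_ge0.
- exact: integral_expRN2.
Qed.

Lemma powR_expRN_le s t : 0 < s -> 0 < t ->
  t `^ s * expR (- t) <= expR (s * (ln (2 * s) - 1)) * expR (- (t / 2)).
Proof.
move=> s0 t0; have -> : - (t / 2) = t / 2 + - t by field.
rewrite expRD mulrA ler_wpM2r ?expR_ge0//; exact: powR_le_expR.
Qed.

Lemma cvg_powR_expRN s : 0 < s -> t `^ s * expR (- t) @[t --> +oo%R] --> 0.
Proof.
move=> s0; pose c := expR (s * (ln (2 * s) - 1)).
apply: (@squeeze_cvgr _ _ _ _ (fun=> 0) (fun t => c * expR (- (t / 2)))).
- exists 0; split => // t t0.
  by rewrite mulr_ge0 ?powR_ge0 ?expR_ge0//= powR_expRN_le.
- exact: cvg_cst.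
- rewrite -[X in _ --> X](mulr0 c); apply: cvgM; first exact: cvg_cst.
  exact: cvg_expRN2.
Qed.

(* The total derivative of [t `^ s * expR (- t)] changes sign; subtracting
   [2 c expR (- t / 2)] makes it nonnegative. *)
Lemma integral_gamma_step s (c := expR (s * (ln (2 * s) - 1))) : 0 < s ->
  (\int[mu]_(t in D)
     (s * g s t - g (s + 1) t + c * expR (- (t / 2)))%:E = (2 * c)%:E)%E.
Proof.
move=> s0; transitivity ((0 - c * 2 * 0) - (0 - c * 2 * 1) : R)%:E; last first.
  by congr EFin; ring.
apply: (@ge0_FTC2_oy _ _
  (fun t => t `^ s * expR (- t) - c * 2 * expR (- (t / 2)))).
- move=> t t0; rewrite addrK -addrA addr_ge0//.
    by rewrite !mulr_ge0 ?powR_ge0 ?expR_ge0// ltW.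
  by rewrite addrC subr_ge0 powR_expRN_le.
- move=> t t0; apply: (@continuousD _ _ _ (fun t => s * g s t - g (s + 1) t)).
    apply: (@continuousB _ _ _ (fun t => s * g s t)).
      apply: (@continuousM _ _ (fun=> s)); first exact: cst_continuous.
      exact: continuous_gamma_integrand.
    exact: continuous_gamma_integrand.
  apply: (@continuousM _ _ (fun=> c)); first exact: cst_continuous.
  exact: continuous_expRN2.
- move=> t t0; have h1 := is_derive1_powR s t0.
  have h2 := is_derive_expRN t; have h3 := is_derive_expRN2 t.
  have h4 := is_deriveM h1 h2.
  have h5 := is_deriveZ (c * 2) h3.
  refine (is_derive_eq (is_deriveB h4 h5) _).
  by rewrite /GRing.scale/= addrK; field.
- apply: cvgB.
    rewrite -[X in _ --> X](mul0r 1); apply: cvgM; first exact: powR_cvg0.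
    apply: cvg_at_right_filter; rewrite [X in _ --> X](_ : 1 = expR (- 0)).
      exact: continuous_expRN.
    by rewrite oppr0 expR0.
  apply: cvgM; first exact: cvg_cst.
  apply: cvg_at_right_filter; rewrite [X in _ --> X](_ : 1 = expR (- (0 / 2))).
    exact: continuous_expRN2.
  by rewrite mul0r oppr0 expR0.
- apply: cvgB; first exact: cvg_powR_expRN.
  apply: cvgM; [exact: cvg_cst|exact: cvg_expRN2].
Qed.

Lemma integrable_gamma_expRN2 (c : R) :
  mu.-integrable D (EFin \o (fun t => c * expR (- (t / 2)))).
Proof. exact: (integrableZl _ c integrable_expRN2). Qed.

Lemma integrable_gammaD1 s : 0 < s -> mu.-integrable D (EFin \o g (s + 1)).
Proof.
move=> s0; pose c := expR (s * (ln (2 * s) - 1)).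
apply: le_integrable (integrable_gamma_expRN2 c) => //.
  exact: measurable_gamma_integrand.
move=> t; rewrite /= in_itv/= andbT => t0.
rewrite lee_fin addrK !ger0_norm ?mulr_ge0 ?powR_ge0 ?expR_ge0//.
exact: powR_expRN_le.
Qed.

Lemma integrable_gamma_step s (c := expR (s * (ln (2 * s) - 1))) : 0 < s ->
  mu.-integrable D (EFin \o
    (fun t => s * g s t - g (s + 1) t + c * expR (- (t / 2)))).
Proof.
move=> s0; apply: (@ge0_integrable_fin _ (2 * c)).
- have mg u := iffLR (measurable_EFinP _ _) (measurable_gamma_integrand u).
  apply/measurable_EFinP/measurable_funD; last first.
    by have /integrableP[/measurable_EFinP] := integrable_gamma_expRN2 c.
  by apply: measurable_funB (mg _); exact: measurable_funM (mg _).
- move=> t t0; rewrite addrK -addrA addr_ge0//.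
    by rewrite !mulr_ge0 ?powR_ge0 ?expR_ge0// ltW.
  by rewrite addrC subr_ge0 powR_expRN_le.
- exact: integral_gamma_step.
Qed.

Lemma integrable_gamma s : 0 < s -> mu.-integrable D (EFin \o g s).
Proof.
move=> s0; pose c := expR (s * (ln (2 * s) - 1)).
have := integrable_gamma_step s s0; have := integrable_gammaD1 s s0 => i1 i2.
(* The dominating function simplifies to [g s t + s^-1 * c * expR (- (t / 2))]: adding [g (s + 1)]
   cancels the negative term of the step integrand. *)
apply: (le_integrable _ _ _ (integrableZl _ s^-1 (integrableD _ i2 i1))) => //.
  exact: measurable_gamma_integrand.
move=> t; rewrite /= in_itv/= andbT => t0.
rewrite lee_fin ger0_norm ?mulr_ge0 ?powR_ge0 ?expR_ge0//.
apply: le_trans (ler_norm _).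
rewrite addrAC subrK mulrDr mulKf ?gt_eqF// lerDl.
by rewrite !mulr_ge0 ?invr_ge0 ?expR_ge0// ltW.
Qed.

(** The correction term alone contributes [2 * c], the whole value found in [integral_gamma_step],
    so the remaining two integrals cancel. *)
Lemma GammaD1 s : 0 < s -> Gamma (s + 1) = s * Gamma s.
Proof.
move=> s0; pose c := expR (s * (ln (2 * s) - 1)).
have ig := integrable_gamma s s0; have ig1 := integrable_gammaD1 s s0.
have isg : mu.-integrable D (EFin \o (fun t => s * g s t)).
  exact: (integrableZl _ s ig).
have isB : mu.-integrable D (EFin \o (fun t => s * g s t - g (s + 1) t)).
  exact: (integrableB _ isg ig1).
have : \int[mu]_(t in D) (s * g s t - g (s + 1) t + c * expR (- (t / 2))) = 2 * c.
  by rewrite /Rintegral integral_gamma_step.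
rewrite RintegralD//; last exact: integrable_gamma_expRN2.
rewrite RintegralB// !RintegralZl//; last exact: integrable_expRN2.
rewrite [X in _ + _ * X](_ : _ = 2); last by rewrite /Rintegral integral_expRN2.
rewrite -!/(Gamma _) => h; lra.
Qed.

Lemma integral_gamma1 : (\int[mu]_(t in D) (g 1 t)%:E = 1%:E)%E.
Proof.
transitivity ((0 - (- 1) : R)%:E); last by congr EFin; ring.
apply: (@ge0_FTC2_oy _ _ (fun t => - expR (- t))).
- by move=> x _; rewrite mulr_ge0 ?powR_ge0 ?expR_ge0.
- by move=> x x0; exact: continuous_gamma_integrand.
- move=> x _; refine (is_derive_eq (is_deriveN (is_derive_expRN x)) _).
  by rewrite opprK subrr powRr0 mul1r.
- apply: cvgN; apply: cvg_at_right_filter.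
  rewrite [X in _ --> X](_ : 1 = expR (- 0)); first exact: continuous_expRN.
  by rewrite oppr0 expR0.
- rewrite [X in _ --> X](_ : 0 = - 0); last by rewrite oppr0.
  by apply: cvgN; exact: cvgr_expR.
Qed.

Lemma Gamma1 : Gamma 1 = 1 :> R.
Proof. by rewrite /Gamma /Rintegral integral_gamma1. Qed.

Lemma Gamma_gt0 s : 0 < s -> 0 < Gamma s.
Proof.
(* On [1, 2] one has [t ^ (s - 1) >= t ^ (-1) >= 1 / 2] because [s > 0], and
   [expR (- t) >= expR (-2)]. *)
move=> s0; apply: (@lt_le_trans _ _ (\int[mu]_(t in `[1, 2]) (expR (-2) / 2))).
  rewrite Rintegral_cst//= lebesgue_measure_itv/= lte_fin ltr1n/=.
  by rewrite mulr_gt0 ?divr_gt0 ?expR_gt0//; lra.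
have mI := @measurable_itv R `[1, 2].
have sub : `[1, 2]%classic `<=` D.
  by move=> t /=; rewrite !in_itv/= andbT => /andP[t1 _]; exact: lt_le_trans t1.
have igI : mu.-integrable `[1, 2] (EFin \o g s).
  by apply: (@integrableS _ _ _ mu _ _ _ _ _ sub (integrable_gamma s s0));
    exact: measurable_itv.
apply: (@le_trans _ _ (\int[mu]_(t in `[1, 2]) (g s t))).
  apply: le_Rintegral => //.
    apply: continuous_compact_integrable; first exact: segment_compact.
    by move=> x; exact: cst_continuous.
  move=> t /=; rewrite in_itv/= => /andP[t1 t2].
  rewrite mulrC ler_pM ?expR_ge0 ?ler_expR ?lerN2//.
  apply: (@le_trans _ _ (t `^ (-1))); last by apply: ler_powR => //; lra.
  by rewrite powR_inv1 ?lef_pV2 ?posrE//; lra.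
apply: fine_le.
- exact: integrable_fin_num.
- by apply: integrable_fin_num => //; exact: integrable_gamma.
apply: ge0_subset_integral => //; first exact: measurable_gamma_integrand.
by move=> t _; rewrite lee_fin mulr_ge0 ?powR_ge0 ?expR_ge0.
Qed.

(** Pointwise, [2 <= r * t ^ (- d) + r^-1 * t ^ d]; integrate against [t ^ (s - 1) * expR (- t)].
    With the weight [r] left free this does the work of the Cauchy-Schwarz inequality. *)
Lemma Gamma_weighted_AM_GM s (d r : R) : 0 <= d < s -> 0 < r ->
  2 * Gamma s <= r * Gamma (s - d) + r^-1 * Gamma (s + d).
Proof.
move=> /andP[d0 ds] r0.
have [s0 sd1 sd2] : [/\ 0 < s, 0 < s - d & 0 < s + d] by split; lra.
have iZ (a u : R) : 0 < u -> mu.-integrable D (EFin \o (fun t => a * g u t)).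
  by move=> u0; exact: (integrableZl _ a (integrable_gamma u u0)).
have IZ (a u : R) : 0 < u -> \int[mu]_(t in D) (a * g u t) = a * Gamma u.
  by move=> u0; rewrite RintegralZl//; exact: integrable_gamma.
rewrite -!IZ// -RintegralD//; [|exact: iZ|exact: iZ].
apply: le_Rintegral => //; first exact: iZ.
  exact: (integrableD _ (iZ r _ sd1) (iZ r^-1 _ sd2)).
move=> t /=; rewrite in_itv/= andbT => t0.
rewrite !mulrA -mulrDl ler_wpM2r ?expR_ge0//.
have -> : s - d - 1 = (s - 1) - d by ring.
have -> : s + d - 1 = (s - 1) + d by ring.
have t1 : t != 0 by rewrite gt_eqF.
rewrite (@powRB _ t (s - 1) d) ?t1 ?implybT//.
rewrite (@powRD _ t (s - 1) d) ?t1 ?implybT//.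
have : 0 < t `^ (s - 1) by exact: powR_gt0.
have : 0 < t `^ d by exact: powR_gt0.
move: (t `^ d) (t `^ (s - 1)) => q p q0 p0; rewrite -subr_ge0.
have -> : r * (p / q) + r^-1 * (p * q) - 2 * p = p * (r - q) ^+ 2 / (r * q).
  by field; rewrite !gt_eqF.
apply: divr_ge0; last by rewrite mulr_ge0 ?ltW.
by apply: mulr_ge0; [exact: ltW|exact: sqr_ge0].
Qed.

(** The choice [r = Gamma s / Gamma (s - d)] turns the first term of the weighted inequality into
    [Gamma s]. *)
Lemma Gamma_midpoint s (d : R) : 0 <= d < s ->
  Gamma s ^+ 2 <= Gamma (s - d) * Gamma (s + d).
Proof.
move=> /[dup] ds0 /andP[d0 ds].
have [s0 sd1 sd2] : [/\ 0 < s, 0 < s - d & 0 < s + d] by split; lra.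
have := Gamma_weighted_AM_GM s d _ ds0.
move: (Gamma_gt0 _ s0) (Gamma_gt0 _ sd1).
move: (Gamma s) (Gamma (s - d)) (Gamma (s + d)) => a b c a0 b0 /(_ (a / b)).
rewrite divr_gt0// divfK ?gt_eqF// invf_div => /(_ isT) h.
have {h} : a <= b / a * c by lra.
by rewrite mulrAC ler_pdivlMr// expr2.
Qed.

End gamma.

(** * Asymptotics of Gamma quotients *)

Section gamma_ratio.
Variables (R : realType) (N : nat).
Hypothesis N0 : (0 < N)%N.
Implicit Types u c s : R.
#[local] Opaque Gamma.
Let d : R := N%:R^-1.
Let q u := Gamma (u + d) / Gamma u.

Let d0 : 0 < d. Proof. by rewrite invr_gt0 ltr0n. Qed.

Let d1 : d <= 1. Proof. by rewrite invf_le1 ?ltr0n// ler1n. Qed.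

Let q_gt0 u : 0 < u -> 0 < q u.
Proof. by move=> u0; apply: divr_gt0; apply: Gamma_gt0; rewrite ?addr_gt0. Qed.

Let le_q u k : 0 < u -> q u <= q (u + k%:R * d).
Proof.
move=> u0; elim: k => [|k IH]; first by rewrite mul0r addr0.
apply: le_trans IH _; set v := u + k%:R * d.
have v0 : 0 < v by apply: ltr_wpDr => //; rewrite mulr_ge0 ?ler0n ?ltW.
have -> : u + k.+1%:R * d = v + d by rewrite /v -natr1; ring.
(* Midpoint log-convexity around [v + d] is exactly [q v <= q (v + d)]. *)
have := @Gamma_midpoint _ (v + d) d; rewrite addrK /q.
have := Gamma_gt0 _ _ v0; have := Gamma_gt0 _ (v + d) (addr_gt0 v0 d0).
move: (Gamma v) (Gamma (v + d)) (Gamma (v + d + d)) => x y z y0 x0 h.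
rewrite ler_pdivrMr// mulrAC ler_pdivlMr// -expr2 mulrC; apply: h.
by rewrite ltW//= ltrDr.
Qed.

Let prod_q u : 0 < u -> \prod_(k < N) q (u + k%:R * d) = u.
Proof.
move=> u0.
have H n : \prod_(k < n) q (u + k%:R * d) = Gamma (u + n%:R * d) / Gamma u.
  elim: n => [|n IH].
    by rewrite big_ord0 mul0r addr0 divff// gt_eqF// Gamma_gt0.
  rewrite big_ord_recr/= IH /q -natr1 mulrDl mul1r addrA.
  have : Gamma (u + n%:R * d) != 0.
    rewrite gt_eqF// Gamma_gt0// ltr_wpDr// mulr_ge0 ?ler0n ?ltW//.
  move: (Gamma _) (Gamma _) (Gamma _) => x y z x0.
  by rewrite mulrC mulrA divfK.
(* Since [N * d = 1], the telescoped quotient is [Gamma (u + 1) / Gamma u = u]. *)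
rewrite H /d divff ?pnatr_eq0 -?lt0n// GammaD1//.
by rewrite mulfK ?gt_eqF ?Gamma_gt0.
Qed.

Let q_le u : 0 < u -> q u ^+ N <= u.
Proof.
move=> u0; rewrite -[leRHS]prod_q//.
have -> : q u ^+ N = \prod_(k < N) q u by rewrite prodr_const card_ord.
by apply: ler_prod => k _; rewrite le_q// ltW// q_gt0.
Qed.

Let q_ge u : 1 < u -> u - 1 <= q (u - d) ^+ N.
Proof.
move=> u1; have u0 : 0 < u - 1 by rewrite subr_gt0.
rewrite -[leLHS]prod_q//.
have -> : q (u - d) ^+ N = \prod_(k < N) q (u - d).
  by rewrite prodr_const card_ord.
apply: ler_prod => k _.
have v0 : 0 < u - 1 + k%:R * d by rewrite ltr_wpDr// mulr_ge0 ?ler0n ?ltW.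
apply/andP; split; first by apply: ltW; exact: q_gt0.
(* The [N] points [u - 1 + k d] end at [u - d], where [q] is therefore largest; [N - 1 - k] steps
   remain from the [k]-th one. *)
have -> : u - d = u - 1 + k%:R * d + (N.-1 - k)%:R * d.
  rewrite -addrA -mulrDl -natrD subnKC; last by rewrite -ltnS prednK.
  rewrite -subn1 natrB// mulrBl mul1r /d divff ?pnatr_eq0 -?lt0n//.
  by rewrite addrA subrK.
exact: le_q.
Qed.

Lemma Gamma_ratio_bounds s : 1 < s ->
  1 <= Gamma (s - d) * Gamma (s + d) / Gamma s ^+ 2 <= s / (s - 1).
Proof.
move=> s1; have s0 : 0 < s by lra.
have sd : 0 < s - d by rewrite subr_gt0 (le_lt_trans d1).
have Gs0 := Gamma_gt0 _ _ s0; have Gsd0 := Gamma_gt0 _ _ sd.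
have ge1 : 1 <= Gamma (s - d) * Gamma (s + d) / Gamma s ^+ 2.
  rewrite ler_pdivlMr ?exprn_gt0// mul1r Gamma_midpoint// ltW//=.
  by rewrite -subr_gt0.
(* A quotient that is at least 1 is at most its [N]-th power, to which the bounds on [q ^ N]
   apply. *)
rewrite ge1/=; apply: le_trans (ler_eXnr N0 ge1) _.
have -> : Gamma (s - d) * Gamma (s + d) / Gamma s ^+ 2 = q s / q (s - d).
  rewrite /q subrK; move: Gs0 Gsd0.
  move: (Gamma s) (Gamma (s - d)) (Gamma (s + d)) => x y z x0 y0.
  by field; rewrite !gt_eqF.
rewrite expr_div_n ler_pM//; first by rewrite exprn_ge0// ltW// q_gt0.
- by rewrite invr_ge0 exprn_ge0// ltW// q_gt0.
- exact: q_le.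
- by rewrite lef_pV2 ?posrE ?subr_gt0// ?exprn_gt0// ?q_gt0// q_ge.
Qed.

Lemma cvg_Gamma_ratio c : 0 < c ->
  Gamma (c - d + n%:R) * Gamma (c + d + n%:R) / Gamma (c + n%:R) ^+ 2
    @[n --> \oo] --> (1 : R).
Proof.
move=> c0.
apply: (@squeeze_cvgr _ _ _ _ (fun=> 1) (fun n => 1 + 2 * harmonic n)).
(* With [s = c + n] the upper bound is [1 + 1 / (c + n - 1)]; for [n >= 3] one has
   [(n + 1) / 2 <= n - 1], hence the bound [1 + 2 / (n + 1)]. *)
- exists 3 => // n /= n3.
  have n3R : (3 : R) <= n%:R by rewrite ler_nat.
  rewrite [c - d + _]addrAC [c + d + _]addrAC.
  have /Gamma_ratio_bounds/andP[-> /=] : 1 < c + n%:R by lra.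
  move=> /le_trans; apply; rewrite /harmonic/= -natr1.
  have -> : (c + n%:R) / (c + n%:R - 1) = 1 + (c + n%:R - 1)^-1.
    by field; rewrite gt_eqF//; lra.
  rewrite lerD2l -[leRHS]invrK lef_pV2 ?posrE; last 2 first.
  - lra.
  - by rewrite invr_gt0 divr_gt0//; lra.
  by rewrite invf_div ler_pdivrMr//; lra.
- exact: cvg_cst.
- rewrite -[X in _ --> X]addr0; apply: cvgD; first exact: cvg_cst.
  rewrite -[X in _ --> X](mulr0 2); apply: cvgM; first exact: cvg_cst.
  exact: cvg_harmonic.
Qed.

Lemma GammaDn c n : 0 < c -> Gamma (c + n%:R) = \prod_(k < n) (c + k%:R) * Gamma c.
Proof.
move=> c0; elim: n => [|n IH]; first by rewrite big_ord0 mul1r addr0.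
rewrite big_ord_recr/= -natr1 addrA GammaD1 ?IH; last by rewrite ltr_wpDr.
by rewrite mulrCA mulrA.
Qed.

Lemma cvg_prod_Gamma c : d < c ->
  \prod_(k < n) ((c + k%:R) ^+ 2 / ((c - d + k%:R) * (c + d + k%:R)))
    @[n --> \oo] --> Gamma (c - d) * Gamma (c + d) / Gamma c ^+ 2.
Proof.
move=> dc.
have [c0 cd0 cD0] : [/\ 0 < c, 0 < c - d & 0 < c + d].
  by split; have := d0; lra.
set L := _ / _.
pose r n := Gamma (c - d + n%:R) * Gamma (c + d + n%:R) / Gamma (c + n%:R) ^+ 2.
have -> : (fun n => \prod_(k < n) ((c + k%:R) ^+ 2 /
    ((c - d + k%:R) * (c + d + k%:R)))) = (fun n => L * (r n)^-1).
  apply/funext => n; rewrite /r /L !GammaDn//.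
  rewrite prodf_div prodrXl big_split/=.
  have P u : 0 < u -> \prod_(k < n) (u + k%:R) != 0.
    by move=> u0; apply/prodf_neq0 => k _; rewrite gt_eqF// ltr_wpDr.
  move: (Gamma_gt0 _ _ c0) (Gamma_gt0 _ _ cd0) (Gamma_gt0 _ _ cD0).
  move: (P _ c0) (P _ cd0) (P _ cD0).
  move: (Gamma _) (Gamma _) (Gamma _) (bigop _ _ _) (bigop _ _ _) (bigop _ _ _).
  move=> x y z a b e a0 b0 e0 x0 y0 z0.
  by field; rewrite a0 b0 e0 !gt_eqF.
rewrite [X in _ --> X](_ : L = L * 1^-1); last by rewrite invr1 mulr1.
apply: cvgM; first exact: cvg_cst.
by apply: cvgV; [exact: oner_neq0|exact: cvg_Gamma_ratio].
Qed.
End gamma_ratio.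

(** * Occurrences of a word *)

Section words.
Local Open Scope nat_scope.
Implicit Types (w s t u : seq bool) (m n : nat).

Lemma size_binexp m : size (binexp m) = up_log 2 m.+1.
Proof. by rewrite size_map size_rev size_iota. Qed.

Lemma binexp_rcons m : 0 < m -> binexp m = rcons (binexp m./2) (odd m).
Proof.
move=> m0; have -> : binexp m =
    [seq odd (m %/ 2 ^ i) | i <- rev (iota 0 (up_log 2 m./2.+1).+1)].
  rewrite /binexp; congr map; congr rev; congr iota.
  apply: up_log_eq => //; rewrite expnS.
  have := @up_logP 2 m./2.+1 isT.
  (* The case [m = 1] is separate, since [up_log_bounds] needs an argument greater than 1. *)
  have [h0|h0] := posnP m./2.
    by rewrite h0 up_log1 expn0; lia.
  have /andP[] := @up_log_bounds 2 m./2.+1 isT h0.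
  case: (up_log 2 _) => [|k] /=; first by rewrite expn0; lia.
  by rewrite expnS; lia.
rewrite /= rev_cons map_rcons divn1 /binexp; congr rcons.
rewrite (iotaDl 1) -map_rev -map_comp; apply: eq_map => i /=.
by rewrite expnD expn1 divnMA divn2.
Qed.

Lemma v2_cat s t : v2 (s ++ t) = v2 s * 2 ^ size t + v2 t.
Proof.
rewrite /v2 foldl_cat.
elim/last_ind: t => [|t b IH] /=; first by rewrite expn0 muln1 addn0.
by rewrite !foldl_rcons IH size_rcons expnS; lia.
Qed.

Lemma v2_rcons s b : v2 (rcons s b) = 2 * v2 s + b.
Proof. by rewrite /v2 foldl_rcons; lia. Qed.

Lemma v2_lt s : v2 s < 2 ^ size s.
Proof.
elim/last_ind: s => // s b IH; rewrite v2_rcons size_rcons expnS.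
by case: b; lia.
Qed.

Lemma v2_inj s t : size s = size t -> v2 s = v2 t -> s = t.
Proof.
elim/last_ind: s t => [|s b IH] t; first by move=> /esym/size0nil->.
case/lastP: t => [|t c]; first by rewrite size_rcons.
rewrite !size_rcons !v2_rcons => -[st] e.
have bc : b = c by case: b c e => -[] //; lia.
by rewrite bc in e *; rewrite (IH t st)//; lia.
Qed.

Lemma v2_nseq k : v2 (nseq k false) = 0.
Proof. by elim: k. Qed.

Lemma v2_eq0 w : (v2 w == 0) = (w == nseq (size w) false).
Proof.
apply/eqP/eqP => [w0|->]; last exact: v2_nseq.
by apply: v2_inj; rewrite ?size_nseq ?v2_nseq.
Qed.

(** Words of equal length are determined by their values, and reduction modulo [2 ^ size w] keeps
    the last [size w] digits. The length condition excludes matches that would use zeros in front of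
    [s]. *)
Lemma suffix_v2 w s : suffix w s = (size w <= size s) && (v2 s %% 2 ^ size w == v2 w).
Proof.
apply/idP/andP => [/suffixP[t ->]|[ws /eqP e]].
  by rewrite size_cat leq_addl v2_cat modnMDl modn_small// v2_lt.
apply/suffixP; exists (take (size s - size w) s).
rewrite -{1}(cat_take_drop (size s - size w) s); congr cat.
have sd : size (drop (size s - size w) s) = size w by rewrite size_drop subKn.
apply: v2_inj => //; rewrite -e -[in RHS](cat_take_drop (size s - size w) s).
by rewrite v2_cat sd modnMDl modn_small// -[X in 2 ^ X]sd v2_lt.
Qed.

Lemma prefix_rconsE (w u : seq bool) b :
  prefix w (rcons u b) = (w == rcons u b) || prefix w u.
Proof.
rewrite !prefixE; have [wu|uw] := leqP (size w) (size u).
  rewrite -cats1 takel_cat//; case: (w =P _) => //= e.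
  by move: wu; rewrite e size_cat addn1 ltnn.
rewrite !take_oversize ?size_rcons// 1?ltnW//.
case: (u =P w) uw => [->|_ _]; first by rewrite ltnn.
by rewrite orbF eq_sym.
Qed.

(** At each position of the longer word, [w] either occurs already in [s] or equals the whole
    remaining tail. These cases exclude each other by length, and the second has at most one
    position, [size t - size w]. *)
Lemma occ_rcons w s b : w != [::] ->
  occ w (rcons s b) = occ w s + suffix w (rcons s b).
Proof.
move=> w0; set t := rcons s b; pose e i := w == drop i t.
have st : size t = (size s).+1 by rewrite size_rcons.
(* The extra position [size s] leaves an empty tail, which does not begin with the non-empty [w];
   both counts now share one range. *)
have -> : occ w s = count (fun i => prefix w (drop i s)) (iota 0 (size t)).
  rewrite st -addn1 iotaD count_cat /= drop_size prefixs0 (negPf w0).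
  by rewrite !addn0.
have -> : suffix w t = count e (iota 0 (size t)) :> nat.
  have -> : count e (iota 0 (size t)) =
      count (fun i => suffix w t && (i == size t - size w)) (iota 0 (size t)).
    apply: eq_in_count => i; rewrite mem_iota add0n => /andP[_ it].
    apply/eqP/andP => [->|[/suffixP[u ->] /eqP ->]].
      by rewrite suffix_drop size_drop subKn// ltnW.
    by rewrite size_cat addnK drop_size_cat.
  case: suffixP => [[u tu]|_] /=; last by rewrite count_pred0.
  rewrite (eq_count (a2 := pred1 (size t - size w))) // count_uniq_mem ?iota_uniq//.
  have /negPf : size w != 0 by rewrite size_eq0.
  rewrite mem_iota; lia.
rewrite /occ -[in LHS]/t -sumn_count -[in RHS]sumn_count -[X in _ = _ + X]sumn_count.
rewrite !sumnE !big_map -big_split/=; apply: eq_big_seq => i.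
rewrite mem_iota add0n st ltnS => /andP[_ it].
rewrite /e /t drop_rcons//; case: (w =P rcons _ _) => [->|/eqP wN].
  rewrite prefix_refl; case: prefixP => // -[u] /(congr1 size).
  by rewrite size_cat size_rcons; lia.
by rewrite prefix_rconsE (negPf wN) /= addn0.
Qed.

(* The binary expansion of m, preceded by zeros, ends in w. *)
Definition ends_in w m : bool := m %% 2 ^ size w == v2 w.

Lemma head_v2 w : head false w -> 2 ^ (size w).-1 <= v2 w.
Proof.
case: w => // -[] // w _; rewrite -[true :: w]/([:: true] ++ w) v2_cat.
by rewrite mul1n leq_addr.
Qed.

(** With padding the word is always long enough for [suffix_v2]. Without it, [ends_in w m] must
    force [m] to have [size w] digits: if [w] begins with 1, then [m >= v2 w >= 2 ^ (size w).-1]; if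
    [w] is a power of 0, then [2 ^ size w] divides [m > 0]. *)
Lemma Nw_half w m : w != [::] -> 0 < m -> Nw w m = Nw w m./2 + ends_in w m.
Proof.
move=> w0 m0; rewrite /Nw; case: ifPn => [hw|_]; last first.
  rewrite binexp_rcons// -rcons_cat occ_rcons// rcons_cat -binexp_rcons//.
  by rewrite suffix_v2 size_cat size_nseq leq_addr v2_cat v2_nseq mul0n add0n v2_binexp.
rewrite {1}binexp_rcons// occ_rcons// -binexp_rcons// suffix_v2 v2_binexp -/(ends_in w m).
case: (boolP (ends_in w m)) => [|_]; rewrite ?andbF// andbT => h.
suff -> : size w <= size (binexp m) by [].
rewrite size_binexp -(leq_exp2l (m := 2))//.
have sw : 0 < size w by rewrite lt0n size_eq0.
have : m < 2 ^ up_log 2 m.+1 by exact: (@up_logP 2 m.+1 isT).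
case/orP: hw => [/head_v2 hw|].
  move: h => /eqP h; have := leq_mod m (2 ^ size w); rewrite h => vm lt.
  have := leq_ltn_trans (leq_trans hw vm) lt.
  by rewrite !leq_exp2l// ltn_exp2l//; lia.
rewrite -v2_eq0 => /eqP v0; move: h; rewrite /ends_in v0 => /dvdn_leq - /(_ m0) h lt.
exact: leq_trans h (ltnW lt).
Qed.

Lemma expn_Nw_le w m : w != [::] -> 0 < m -> 2 ^ Nw w m <= 2 * m.
Proof.
move=> w0; elim/ltn_ind: m => m IH m0; rewrite Nw_half//.
case: (posnP m./2) => [h|h].
  have -> : m = 1 by lia.
  by rewrite Nw0//; case: ends_in.
have := IH m./2 _ h; rewrite expnD => /(_ ltac:(lia)).
by case: ends_in => /=; rewrite ?expn1 ?expn0; lia.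
Qed.

(** The factor 2 accounts for [n = 3], where 9 exceeds 8. This weakens the logarithmic bound
    [expn_Nw_le] to the square-root bound used for the tail. *)
Lemma sqrn_le_expn n : n ^ 2 <= 2 * 2 ^ n.
Proof.
case: n => [|[|[|n]]] //; elim: n => [|n IH] //.
by move: IH; rewrite !expnS expn0; nia.
Qed.

Lemma sqr_Nw_le w m : w != [::] -> 0 < m -> Nw w m ^ 2 <= 4 * m.
Proof.
move=> w0 m0; have := sqrn_le_expn (Nw w m); have := expn_Nw_le w m w0 m0; lia.
Qed.

End words.

(** * Telescoping *)

Section product.
Variable R : realType.
Implicit Types (w : seq bool) (m n M : nat).

(* The value at 0 is a convention: the formula would give 1 / 0 = 0. *)
Definition dyadic_factor m : R :=
  if m == 0%N then 1 else (2 * m + 1)%:R ^+ 2 / ((2 * m)%:R * (2 * m + 2)%:R).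

Local Notation x := dyadic_factor.

Lemma dyadic_factorE m : (0 < m)%N ->
  x m = (2 * m + 1)%:R ^+ 2 / ((2 * m)%:R * (2 * m + 2)%:R).
Proof. by rewrite /dyadic_factor; case: m. Qed.

Lemma dyadic_factor_split n : (0 < n)%N ->
  x n = (((4 * n + 2)%:R * (4 * n + 2)%:R) / ((4 * n + 1)%:R * (4 * n + 3)%:R)) ^+ 2
        * (x (2 * n) * x (2 * n).+1).
Proof.
move=> n0; rewrite !dyadic_factorE ?muln_gt0//.
have n1 : 0 < n%:R :> R by rewrite ltr0n.
rewrite -[(2 * n).+1]addn1 !(natrM, natrD).
by field; do ?[apply/andP; split]; rewrite gt_eqF//; lra.
Qed.

(** Since [(2m+1)^2 = 4m(m+1) + 1], the factor is [1 + 1 / (4m(m+1))]. *)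
Lemma dyadic_factor_bounds m n : (0 < n <= m)%N ->
  1 <= x m <= 1 + (4 * n%:R ^+ 2)^-1.
Proof.
move=> /andP[n0 nm]; have m0 := leq_trans n0 nm; rewrite dyadic_factorE//.
have m1 : 0 < m%:R :> R by rewrite ltr0n.
have n1 : 0 < n%:R :> R by rewrite ltr0n.
have nm1 : n%:R <= m%:R :> R by rewrite ler_nat.
have -> : (2 * m + 1)%:R ^+ 2 / ((2 * m)%:R * (2 * m + 2)%:R) =
    1 + (4 * (m%:R * (m%:R + 1)))^-1 :> R.
  rewrite !(natrM, natrD); field.
  by do ?[apply/andP; split]; rewrite gt_eqF//; lra.
rewrite lerDl lerD2l invr_ge0 lef_pV2 ?posrE; last 2 first.
- by rewrite !mulr_gt0//; lra.
- by rewrite !mulr_gt0// exprn_gt0.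
by apply/andP; split; nra.
Qed.

(** Passing from [M] to [n = M + 1] adds the indices [2n] and [2n + 1], both with half [n];
    [Nw_half] separates their exponents and [dyadic_factor_split] rewrites [x n]. The form without
    division reduces the step to ring identities. *)
Lemma partial_prod_telescope w M : w != [::] ->
  partial_prod w M * \prod_(m < M.+1.*2) x m ^+ Nw w m =
  \prod_(m < M.+1.*2) x m ^+ ends_in w m * \prod_(m < M.+1) x m ^+ Nw w m.
Proof.
move=> w0; elim: M => [|M IH].
  rewrite /partial_prod big_geq// !big_ord_recl !big_ord0/=.
  rewrite (Nw_half w 1)// Nw0//= !mulr1 expr0 !mul1r.
  by rewrite /dyadic_factor/= expr1n mul1r.
set n := M.+1; rewrite doubleS ![\prod_(m < n.*2.+2) _]big_ord_recr.
rewrite ![\prod_(m < n.*2.+1) _]big_ord_recr/=.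
rewrite [\prod_(m < n.+1) _]big_ord_recr/=.
have -> : partial_prod w n = partial_prod w M *
    ((((4 * n + 2)%:R * (4 * n + 2)%:R) / ((4 * n + 1)%:R * (4 * n + 3)%:R)) ^+ 2)
     ^+ Nw w n :> R.
  by rewrite /partial_prod big_nat_recr// exprM.
rewrite (Nw_half w n.*2)// (Nw_half w n.*2.+1)// doubleK.
have -> : (n.*2.+1)./2 = n by rewrite -uphalfE uphalf_double.
rewrite (dyadic_factor_split n)// !mul2n.
move: IH; rewrite -/n; move: (_ ^+ 2) (x n.*2) (x n.*2.+1) => f y z.
rewrite !exprMn !exprD.
move: (f ^+ _) (y ^+ Nw w n) (z ^+ Nw w n) (y ^+ ends_in w _) (z ^+ ends_in w _).
move: (partial_prod w M) (\prod_(m < n.*2) x m ^+ Nw w m).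
move: (\prod_(m < n.*2) _) (\prod_(m < n) _).
move=> h b p a f' y' z' y'' z'' IH.
transitivity ((p * a) * (f' * (y' * z') * (y'' * z''))); first by ring.
by rewrite IH; ring.
Qed.

Lemma prod_dyadic_factor_tail n : (0 < n)%N -> forall w, w != [::] ->
  1 <= \prod_(k < n) x (n + k) ^+ Nw w (n + k) <= expR (Num.sqrt n%:R^-1).
Proof.
move=> n0 w w0; set sg := Num.sqrt _.
have nR : 0 < n%:R :> R by rewrite ltr0n.
have sg0 : 0 < sg by rewrite sqrtr_gt0 invr_gt0.
have sgE : n%:R * sg ^+ 2 = 1 by rewrite sqr_sqrtr ?invr_ge0 ?ler0n// divff ?gt_eqF.
(* Here [sg = 1 / sqrt n]. From [Nw ^ 2 <= 4 (n + k) <= 8 n] follows [Nw <= 4 n sg], and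
   [4 n sg / (4 n ^ 2) = sg / n]; the [n] factors multiply to [expR sg]. *)
have H (k : 'I_n) : 1 <= x (n + k) ^+ Nw w (n + k) <= expR (sg / n%:R).
  have /(@dyadic_factor_bounds (n + k) n)/andP[x1 xle] : (0 < n <= n + k)%N.
    by rewrite n0 leq_addr.
  rewrite exprn_ege1//=.
  apply: (@le_trans _ _ (expR ((4 * n%:R ^+ 2)^-1) ^+ Nw w (n + k))).
    rewrite lerXn2r ?nnegrE ?expR_ge0//; first exact: le_trans x1.
    exact: le_trans xle (expR_ge1Dx _).
  rewrite -expRM_natl ler_expR.
  have N4 : (Nw w (n + k))%:R <= 4 * n%:R * sg :> R.
    rewrite -ler_sqr ?nnegrE ?ler0n//; last by rewrite !mulr_ge0 ?ltW.
    apply: (@le_trans _ _ (8 * n%:R)).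
      rewrite -natrX -natrM ler_nat.
      apply: leq_trans (sqr_Nw_le w _ w0 _) _; first by rewrite addn_gt0 n0.
      by have := ltn_ord k; lia.
    have -> : (4 * n%:R * sg) ^+ 2 = 16 * n%:R * (n%:R * sg ^+ 2) by ring.
    by rewrite sgE; lra.
  have -> : sg / n%:R = 4 * n%:R * sg / (4 * n%:R ^+ 2).
    by field; rewrite gt_eqF.
  by rewrite ler_wpM2r// invr_ge0 mulr_ge0// sqr_ge0.
apply/andP; split.
  by elim/big_ind : _ => // [a b|k _]; [exact: mulr_ege1|have /andP[] := H k].
have -> : expR sg = \prod_(k < n) expR (sg / n%:R).
  by rewrite prodr_const card_ord -expRM_natl mulrC divfK ?gt_eqF.
by apply: ler_prod => k _; have /andP[/(le_trans ler01) -> ->] := H k.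
Qed.

(** The indices ending in [w] are [q k + v] with [q = 2 ^ size w] and [v = v2 w < q]. The number of
    them below [n] is [(n - v) / q] rounded up, written here so that no truncated subtraction occurs
    when [n < v]. *)
Lemma prod_ends_in w (g : nat -> R) n : 
  \prod_(m < n) g m ^+ ends_in w m =
  \prod_(k < (n + (2 ^ size w - (v2 w).+1)) %/ 2 ^ size w) g (2 ^ size w * k + v2 w)%N.
Proof.
have vq := v2_lt w; set q := (2 ^ size w)%N in vq *; set v := v2 w in vq *.
elim: n => [|n IH]; first by rewrite add0n divn_small ?big_ord0//; lia.
rewrite big_ord_recr/= IH addSn divnS; last lia.
(* The quotient grows from [n] to [n + 1] exactly when [q] divides [n + q - v], that is, when [n] is
   congruent to [v]. *)
have dE : (q %| (n + (q - v.+1)).+1)%N = ends_in w n.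
  rewrite /ends_in -/q -/v -[v in RHS](modn_small vq) -(eqn_modDr (q - v)).
  by rewrite subnKC ?modnn 1?ltnW// /dvdn; congr (_ %% _ == _)%N; lia.
rewrite dE; case: (boolP (ends_in w n)) => [|_]; last by rewrite expr0 mulr1 add0n.
rewrite /ends_in -/q -/v => /eqP h; rewrite add1n big_ord_recr/= expr1.
congr (_ * g _); have := divn_eq n q; rewrite h => nE.
suff -> : ((n + (q - v.+1)) %/ q = n %/ q)%N by rewrite mulnC.
rewrite {1}nE -addnA divnMDl; last lia.
by rewrite (@divn_small (v + _)) ?addn0//; lia.
Qed.
End product.

Arguments dyadic_factor {R} m%_N.

(** * Passage to the limit *)

Section limits.
Variable R : realType.
Implicit Types (w : seq bool) (m n M : nat).
Local Notation x := (@dyadic_factor R).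

Lemma cvg_sqrt_harmonic : Num.sqrt (n.+1%:R^-1 : R) @[n --> \oo] --> (0 : R).
Proof.
rewrite -[X in _ --> X]sqrtr0.
apply: (@cvg_comp _ _ _ (@harmonic R) (fun y => Num.sqrt y)).
  exact: cvg_harmonic.
exact: sqrt_continuous.
Qed.

Lemma cvg_prod_dyadic_factor_tail w : w != [::] ->
  \prod_(k < M.+1) x (M.+1 + k) ^+ Nw w (M.+1 + k) @[M --> \oo] --> (1 : R).
Proof.
move=> w0.
apply: (@squeeze_cvgr _ _ _ _ (fun=> 1) (fun M => expR (Num.sqrt (M.+1%:R^-1)))).
- by apply: nearW => M; exact: prod_dyadic_factor_tail.
- exact: cvg_cst.
- rewrite -[X in _ --> X]expR0.
  apply: (@cvg_comp _ _ _ (fun M => Num.sqrt (M.+1%:R^-1)) expR).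
    exact: cvg_sqrt_harmonic.
  exact: continuous_expR.
Qed.

Lemma cvg_partial_prod w (l : R) : w != [::] ->
  \prod_(k < n) x (2 ^ size w * k + v2 w) @[n --> \oo] --> l ->
  partial_prod w M @[M --> \oo] --> l.
Proof.
move=> w0 cl; set q := (2 ^ size w)%N in cl *.
pose P n : R := \prod_(k < n) x (q * k + v2 w).
pose K M := ((M.+1.*2 + (q - (v2 w).+1)) %/ q)%N.
pose T M : R := \prod_(k < M.+1) x (M.+1 + k) ^+ Nw w (M.+1 + k).
have Tpos M : T M != 0.
  rewrite gt_eqF// (lt_le_trans ltr01)//.
  by have /andP[] := @prod_dyadic_factor_tail R M.+1 isT w w0.
(* Splitting the product over [m < 2M + 2] at [M + 1] gives a lower half that occurs on both sides
   of the telescoping identity and cancels, and the upper half [T M]. *)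
have -> : (fun M => partial_prod w M) = (fun M => P (K M) * (T M)^-1).
  apply/funext => M; have := @partial_prod_telescope R w M w0.
  rewrite prod_ends_in -/q -/(P (K M)) -addnn big_split_ord/=.
  rewrite -/(T M); set A := \prod_(i < M.+1) _ => e.
  have A0 : A != 0.
    apply/prodf_neq0 => i _; rewrite expf_neq0// gt_eqF// (lt_le_trans ltr01)//.
    case: (posnP i) => [->//|i0].
    by have /andP[] := @dyadic_factor_bounds R i i (introT andP (conj i0 (leqnn _))).
  apply/eqP; rewrite -(inj_eq (mulIf A0)) mulrAC -e; apply/eqP.
  by field; exact: Tpos.
rewrite [X in _ --> X](_ : l = l * 1^-1); last by rewrite invr1 mulr1.
apply: cvgM.
  apply: (@cvg_comp _ _ _ K P _ \oo) cl.
  apply/cvgnyPge => A; exists (q * A)%N => // M /= qA.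
  have q0 : (0 < q)%N by rewrite expn_gt0.
  by rewrite leq_divRL// mulnC; lia.
by apply: cvgV; [exact: oner_neq0|exact: cvg_prod_dyadic_factor_tail].
Qed.

End limits.

(** * Evaluation of the limits *)

Lemma cvg_prod_dyadic_factor (R : realType) (q v : nat) : (0 < v)%N -> (0 < q)%N ->
  \prod_(k < n) (dyadic_factor (q * k + v) : R) @[n --> \oo] -->
    Gamma (v%:R / q%:R) * Gamma ((v + 1)%:R / q%:R)
      / Gamma ((2 * v + 1)%:R / (2 * q)%:R) ^+ 2.
Proof.
move=> v0 q0; have qR : 0 < q%:R :> R by rewrite ltr0n.
have vR : 0 < v%:R :> R by rewrite ltr0n.
have q20 : (0 < 2 * q)%N by rewrite muln_gt0.
pose c : R := (2 * v + 1)%:R / (2 * q)%:R.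
pose d : R := (2 * q)%:R^-1.
have dE : d = (2 * q%:R)^-1 by rewrite /d natrM.
have -> : v%:R / q%:R = c - d.
  by rewrite dE /c !(natrM, natrD); field; rewrite gt_eqF.
have -> : (v + 1)%:R / q%:R = c + d.
  by rewrite dE /c !(natrM, natrD); field; rewrite gt_eqF.
rewrite -/c; have := @cvg_prod_Gamma R _ q20 c; rewrite -/d.
(* Numerator and denominator of each factor are divided by [(2 q) ^ 2]. *)
have -> : (fun n => \prod_(k < n) dyadic_factor (q * k + v) : R) =
    (fun n => \prod_(k < n) ((c + k%:R) ^+ 2 / ((c - d + k%:R) * (c + d + k%:R)))).
  apply/funext => n; apply: eq_bigr => k _.
  rewrite dyadic_factorE ?addn_gt0 ?v0 ?orbT// dE /c !(natrM, natrD).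

  have qk0 : 0 <= q%:R * k%:R :> R by rewrite mulr_ge0 ?ler0n.
  by field; do ?[apply/andP; split]; rewrite gt_eqF//; nra.
apply; rewrite dE /c !(natrM, natrD) -subr_gt0.
have -> : (2 * v%:R + 1) / (2 * q%:R) - (2 * q%:R)^-1 = v%:R / q%:R :> R.
  by field; rewrite gt_eqF.
exact: divr_gt0.
Qed.

(** The term [k = 0] equals 1 by convention; dropping it leaves the previous product with [v = q].
    The functional equation then lowers the arguments [1 + 1/q] and [1 + 1/(2q)], with the factor
    [(1/q) / (1/(2q)) ^ 2 = 4 q]. *)
Lemma cvg_prod_dyadic_factor0 (R : realType) (q : nat) : (0 < q)%N ->
  \prod_(k < n) (dyadic_factor (q * k) : R) @[n --> \oo] -->
    4 * q%:R * Gamma (1 / q%:R) / Gamma (1 / (2 * q)%:R) ^+ 2.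
Proof.
move=> q0; have qR : 0 < q%:R :> R by rewrite ltr0n.
have q20 : (0 < 2 * q)%N by rewrite muln_gt0.
rewrite -cvg_shiftS/=.
have -> : (fun n => \prod_(k < n.+1) dyadic_factor (q * k) : R) =
    (fun n => \prod_(k < n) dyadic_factor (q * k + q)).
  apply/funext => n; rewrite big_ord_recl muln0 [dyadic_factor 0]/dyadic_factor/=.
  rewrite mul1r; apply: eq_bigr => k _.
  by rewrite /bump/= add1n mulnS addnC.
suff -> : 4 * q%:R * Gamma (1 / q%:R) / Gamma (1 / (2 * q)%:R) ^+ 2 =
    Gamma (q%:R / q%:R) * Gamma ((q + 1)%:R / q%:R)
      / Gamma ((2 * q + 1)%:R / (2 * q)%:R) ^+ 2 :> R.
  exact: cvg_prod_dyadic_factor.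
have -> : q%:R / q%:R = 1 :> R by rewrite divff// gt_eqF.
have -> : (q + 1)%:R / q%:R = 1 / q%:R + 1 :> R.
  by rewrite natrD mulrDl divff ?gt_eqF// addrC.
have -> : (2 * q + 1)%:R / (2 * q)%:R = 1 / (2 * q)%:R + 1 :> R.
  by rewrite natrD mulrDl divff ?pnatr_eq0 -?lt0n// addrC.
have u0 : 0 < 1 / q%:R :> R by rewrite divr_gt0.
have v0 : 0 < 1 / (2 * q)%:R :> R by rewrite divr_gt0 ?ltr0n.
rewrite (GammaD1 _ _ u0) (GammaD1 _ _ v0) Gamma1 natrM.
rewrite natrM in v0; have := Gamma_gt0 _ _ v0.
move: (Gamma (1 / (2 * _))) (Gamma (1 / q%:R)) => a b a0.
by field; rewrite !gt_eqF.
Qed.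

Theorem theorem1 (R : realType) (w : seq bool) (w_neq0 : w <> [::]) :
  (forall j : nat, (1 <= j)%N -> w = nseq j false ->
     (@partial_prod R w M @[M --> \oo] -->
        (2 : R) ^+ (j + 2) * Gamma ((1 : R) / 2 ^+ j) / Gamma (1 / 2 ^+ (j + 1)) ^+ 2))
  /\
  ((forall j : nat, (1 <= j)%N -> w <> nseq j false) ->
     (@partial_prod R w M @[M --> \oo] -->
        Gamma ((v2 w)%:R / (2 : R) ^+ size w) * Gamma ((v2 w + 1)%:R / 2 ^+ size w)
          / Gamma ((2 * v2 w + 1)%:R / 2 ^+ (size w + 1)) ^+ 2)).
Proof.
have w0 : w != [::] by apply/eqP.
split=> [j j1 wj|wj].
  apply: cvg_partial_prod => //.
  rewrite wj size_nseq v2_nseq.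
  have h := @cvg_prod_dyadic_factor0 R (2 ^ j) (expn_gt0 2 j).
  have -> : 2 ^+ (j + 2) = 4 * 2 ^+ j :> R by rewrite exprD mulrC -[2 ^+ 2]natrX.
  rewrite -expnS !natrX in h; rewrite addn1.
  under eq_fun do under eq_bigr do rewrite addn0.
  exact: h.
apply: cvg_partial_prod => //.
have v0 : (0 < v2 w)%N.
  rewrite lt0n v2_eq0; apply/eqP => we; apply: wj we.
  by rewrite lt0n size_eq0.
have h := @cvg_prod_dyadic_factor R (2 ^ size w) (v2 w) v0 (expn_gt0 2 _).
rewrite -expnS !natrX in h; rewrite [(size w + 1)%N]addn1; exact: h.
Qed.
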